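(* Let $p$ be a prime, let $G\cong \mathbb{Z}_p^n$, and let $\mathcal{CM}$ be a regular Cayley map of $G$. Suppose that a point-stabiliser $\langle \sigma\rangle$ of $\mathrm{Aut}(\mathcal{CM})$ has order $kp^m$, where $m\ge 0$ and $p\nmid k$. Then $$\mathrm{Aut}(\mathcal{CM})=(G\rtimes \langle \sigma^k\rangle)\rtimes \langle \sigma^{p^m}\rangle .$$ Moreover, $\mathrm{Aut}(\mathcal{CM})$ contains a normal subgroup $T\cong \mathbb{Z}_p^n$ acting regularly on the vertices such that either $T=G$, or $T\cap G\cong \mathbb{Z}_p^{n-1}$ where $n\ge 2$.
   Context: For a finite group $G$, an inverse-closed generating set $S\subseteq G\setminus\{1\}$ and a cyclic permutation $\rho$ of $S$, the Cayley map $\mathrm{CM}(G,S,\rho)$ is the 2-cell embedding of the Cayley graph $\mathrm{Cay}(G,S)$ (vertices $G$, arcs $(g,gs)$, $s\in S$) into an orientable closed surface in which the local rotation at every vertex $g$ sends the arc $(g,gs)$ to $(g,g\rho(s))$. $\mathrm{Aut}(\mathcal{CM})$ denotes the group of orientation-preserving map automorphisms; it contains the left regular representation of $G$, which is identified with $G$ and acts regularly on vertices. The Cayley map is regular if $\mathrm{Aut}(\mathcal{CM})$ acts regularly on arcs; then the stabiliser of a vertex (point-stabiliser) is cyclic, generated by an element $\sigma$. *)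

(* Defs.v *)
From mathcomp Require Import all_boot all_order all_fingroup all_algebra all_solvable.

Set Implicit Arguments.
Unset Strict Implicit.
Unset Printing Implicit Defensive.

Local Open Scope group_scope.

(* Unlike [transitive A, on X | to], this does not force X to be nonempty:   *)
(* the one-vertex Cayley map of the trivial group has no arcs.                *)
Definition acts_regularly (aT : finGroupType) (T : finType)
    (A : {set aT}) (to : {action aT &-> T}) (X : {set T}) : Prop :=
  [acts A, on X | to] /\ {in X &, forall x y, #|amove to A x y| = 1%N}.

Section PairAction.
Variable T : finType.

Definition pair_perm (a : T * T) (f : {perm T}) : T * T := (f a.1, f a.2).

Lemma pair_perm1 : pair_perm^~ 1 =1 id.
Proof. by case=> x y; rewrite /pair_perm /= !perm1. Qed.

Lemma pair_permM a : act_morph pair_perm a.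
Proof. by move=> f g; rewrite /pair_perm /= !permM. Qed.

Canonical pair_action := TotalAction pair_perm1 pair_permM.

End PairAction.

(* The embedding in the oriented surface is encoded by its rotation system.   *)
(* The permutation cm_rot of the whole group is trivial outside cm_set, where *)
(* it consists of a single cycle.                                             *)
Record cayley_map (gT : finGroupType) := CayleyMap {
  cm_set : {set gT};
  cm_rot : {perm gT};
  cm_set1 : 1 \notin cm_set;
  cm_setV : {in cm_set, forall s, s^-1 \in cm_set};
  cm_gen : <<cm_set>> = [set: gT];
  cm_rot_on : perm_on cm_set cm_rot;
  cm_rot_cycle : {in cm_set, forall s, porbit cm_rot s = cm_set}
}.

Section CayleyMapAut.
Variables (gT : finGroupType) (M : cayley_map gT).

(* The arc (g, g s) is represented by its pair of end vertices. *)
Definition cm_arcs : {set gT * gT} := [set a | a.1^-1 * a.2 \in cm_set M].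

(* (g, g s) |-> (g, g rho(s)) *)
Definition cm_rotation (a : gT * gT) : gT * gT :=
  (a.1, a.1 * cm_rot M (a.1^-1 * a.2)).

(* The Cayley graph is simple, so a map automorphism is determined by its     *)
(* action on vertices: it is a graph automorphism whose induced action on     *)
(* arcs commutes with the rotation.                                           *)
Definition cm_aut : {set {perm gT}} :=
  [set f | [forall a, (pair_action gT a f \in cm_arcs) == (a \in cm_arcs)]
        && [forall a in cm_arcs,
              pair_action gT (cm_rotation a) f
                == cm_rotation (pair_action gT a f)]].

Lemma cm_autP (f : {perm gT}) :
  reflect ((forall a, (pair_action gT a f \in cm_arcs) = (a \in cm_arcs)) /\
           {in cm_arcs, forall a, pair_action gT (cm_rotation a) f
                                  = cm_rotation (pair_action gT a f)})
          (f \in cm_aut).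
Proof.
rewrite inE; apply: (iffP andP) => -[H1 H2]; split.
- by move=> a; apply/eqP; apply: (forallP H1).
- by move=> a aA; apply/eqP; apply: (forall_inP H2).
- by apply/forallP => a; rewrite H1.
- by apply/forall_inP => a aA; rewrite H2.
Qed.

Lemma cm_aut_group_set : group_set cm_aut.
Proof.
apply/group_setP; split.
  by apply/cm_autP; split=> [a|a _]; rewrite !act1.
move=> f g /cm_autP[fA fR] /cm_autP[gA gR].
apply/cm_autP; split=> [a|a aA]; first by rewrite actM gA fA.
by rewrite !actM fR // gR // fA.
Qed.
Canonical cm_aut_group := Group cm_aut_group_set.

Definition regular_cayley_map : Prop :=
  acts_regularly cm_aut (pair_action gT) cm_arcs.

End CayleyMapAut.

Section LeftRegular.
Variable gT : finGroupType.

Definition lmul_perm (g : gT) : {perm gT} := perm (mulgI g).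

Definition left_regular : {set {perm gT}} := [set lmul_perm g | g : gT].

Lemma left_regular_group_set : group_set left_regular.
Proof.
apply/group_setP; split.
  apply/imsetP; exists 1 => //.
  by apply/permP => x; rewrite perm1 permE mul1g.
move=> _ _ /imsetP[g _ ->] /imsetP[h _ ->]; apply/imsetP; exists (h * g) => //.
by apply/permP => x; rewrite permM !permE /= mulgA.
Qed.
Canonical left_regular_group := Group left_regular_group_set.

Lemma left_regular_sub_aut (M : cayley_map gT) : left_regular \subset cm_aut M.
Proof.
apply/subsetP => _ /imsetP[g _ ->]; apply/cm_autP.
have E x y : (g * x)^-1 * (g * y) = x^-1 * y by rewrite invMg -mulgA mulKg.
split=> [[x y]|[x y] _]; first by rewrite !inE /= !permE E.
by rewrite /cm_rotation /= /pair_perm /= !permE E mulgA.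
Qed.

End LeftRegular.

(* Main.v *)
(* Write A = Aut(CM), G for the translations and C = <sigma>, so A = GC.       *)
(* For p = 2 the flip of an arc at x is a translation, and sigma permutes the *)
(* flips of the arcs at x, so G is normal in A and T = G.                      *)
(* For p odd let T = A', which is abelian by Ito's theorem. Modulo TC every    *)
(* generating translation is an involution of odd order, so A = TC; thus T is *)
(* transitive, hence regular. If T <> G, then W = G /\ T has index p in G      *)
(* because A/T is cyclic, L = GT has centre W, and L/W has order p^2. So L     *)
(* has class 2 and is generated by elements of order p, and T is elementary   *)
(* abelian. Finally T/W, of order p, is central in the p-group T<sigma^k>/W,   *)
(* so sigma^k centralises L/W and therefore normalises G.                      *)

Require Import Defs.
From mathcomp Require Import all_boot all_order all_fingroup all_algebra all_solvable.

Set Implicit Arguments.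
Unset Strict Implicit.
Unset Printing Implicit Defensive.

Local Open Scope group_scope.

(** A transitive abelian subgroup of A = Aut(CM) is regular, so it complements the cyclic stabiliser
    C, and it contains its own centraliser ([transitive_abelian_cent_sub]). Automorphisms reversing
    an arc provide a normal such T: T = G for p = 2 ([cm_aut_stab_norm2]), and T = A' for p odd,
    abelian by [der1_mul_abelian] and transitive by [left_regular_sub_der1_stab]. What remains
    concerns an abstract group A = GC = TC. If T differs from G, comparing them inside L = GT, whose
    centre is W = G :&: T, shows that T is elementary abelian ([complement_abelem]) and that
    p-elements of C normalise G ([complement_pelt_norm]). The decomposition then follows from Sylow
    theory ([sdprod_cycle_constituents]). *)

(** * Products of two abelian groups *)

Lemma der1_mul_abelian_commg (gT : finGroupType) (G A B : {group gT}) :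
  abelian A -> abelian B -> A * B = G -> G^`(1) = [~: A, B].
Proof.
move=> abA abB defG; have [sAG sBG] := mulG_sub defG.
apply/eqP; rewrite eqEsubset (commgSS sAG sBG) andbT.
have nRG : G \subset 'N([~: A, B]).
  by rewrite -defG mulG_subG commg_norml commg_normr.
rewrite der1_min // -defG quotientMl; last exact: subset_trans sAG nRG.
rewrite abelianM !quotient_abelian //= quotient_cents2 //.
- by rewrite commGC.
- exact: subset_trans sBG nRG.
- exact: subset_trans sAG nRG.
Qed.

(* Ito's theorem *)
Lemma der1_mul_abelian (gT : finGroupType) (G A B : {group gT}) :
  abelian A -> abelian B -> A * B = G -> abelian G^`(1).
Proof.
move=> abA abB defG; rewrite (der1_mul_abelian_commg abA abB defG).
have [sAG sBG] := mulG_sub defG.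
(* With [b ^ x = a1 * b1] and [a ^ y = b2 * a2], both sides reduce to [[~ a2, b1]]. *)
have conj_comm a b x y : a \in A -> b \in B -> x \in A -> y \in B ->
  [~ a, b] ^ (x * y) = [~ a, b] ^ (y * x).
  move=> Aa Bb Ax By.
  have : b ^ x \in A * B by rewrite defG groupJ ?(subsetP sAG x, subsetP sBG b).
  case/mulsgP=> a1 b1 Aa1 Bb1 bx.
  have : a ^ y \in B * A.
    have cAB : commute A B by apply/comm_group_setP; rewrite defG groupP.
    by rewrite -cAB defG groupJ ?(subsetP sAG a, subsetP sBG y).
  case/mulsgP=> b2 a2 Bb2 Aa2 ay.
  have cA u v : u \in A -> v \in A -> u ^ v = u.
    by move=> Au Av; rewrite conjgE (centsP abA u Au v Av) mulKg.
  have cB u v : u \in B -> v \in B -> u ^ v = u.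
    by move=> Au Av; rewrite conjgE (centsP abB u Au v Av) mulKg.
  have cA1 u v : u \in A -> v \in A -> [~ u, v] = 1.
    by move=> Au Av; rewrite commgEl cA ?mulVg.
  have cB1 u v : u \in B -> v \in B -> [~ u, v] = 1.
    by move=> Au Av; rewrite commgEl cB ?mulVg.
  have step u : u \in A -> [~ u, a1 * b1] = [~ u, b1].
    by move=> Au; rewrite commgMJ (cA1 u a1) // conj1g mulg1.
  have step' u : u \in B -> [~ b2 * a2, u] = [~ a2, u].
    by move=> Bu; rewrite commMgJ (cB1 b2 u) // conj1g mul1g.
  have -> : [~ a, b] ^ (x * y) = [~ a2, b1].
    by rewrite conjgM conjRg (cA a) // bx step // conjRg ay (cB b1) // step'.
  by rewrite conjgM conjRg ay (cB b) // step' // conjRg (cA a2) // bx step.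
rewrite abelian_gen; apply/centsP=> _ /imset2P[a b Aa Bb ->].
move=> _ /imset2P[x y Ax By ->].
have := conj_comm a b x^-1 y^-1 Aa Bb; rewrite !groupV => /(_ Ax By) E.
apply/commgP/conjg_fixP; rewrite (commgEl x y) conjgE.
(* By [E] the two products conjugate [[~ a, b]] to the same element, so their quotient [[~ x, y]]
   centralises it. *)
rewrite (_ : x^-1 * _ = (x^-1 * y^-1) * (y^-1 * x^-1)^-1); last first.
  by rewrite invMg !invgK !mulgA.
by rewrite conjgM E -conjgM mulgV conjg1.
Qed.

(** * Two complements G and T of a cyclic subgroup, with T normal *)

Section CyclicFactor.

Variables (gT : finGroupType) (p : nat) (A G T : {group gT}) (s : gT).
Local Notation C := <[s]>.
Hypotheses (p_pr : prime p) (pG : p.-abelem G) (nsTA : T <| A) (sGA : G \subset A).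
Hypotheses (defAG : G * C = A) (defAT : T * C = A).
Hypotheses (tiGC : G :&: C = 1) (tiTC : T :&: C = 1).

Lemma card_complements_cycle : #|T| = #|G|.
Proof.
have := TI_cardMg tiGC; have := TI_cardMg tiTC; rewrite defAG defAT => -> /eqP.
by rewrite eqn_pmul2r // => /eqP.
Qed.

Lemma abelian_quo_cyclic_complement : abelian (A / T).
Proof.
have sCA : C \subset A by rewrite -defAT mulG_subr.
have nTC : C \subset 'N(T) by apply: subset_trans sCA (normal_norm nsTA).
by rewrite -defAT quotientMidl cyclic_abelian // quotient_cyclic // cycle_cyclic.
Qed.

(** The p-group [P] = T<s^k> contains A', since A/T is abelian, so it is normal; its index k is
    prime to p, so it contains the p-group G. Comparing orders, [P] = G<s^k>, and <s^(p^m)>, of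
    order k, complements it. *)
Lemma sdprod_cycle_constituents (k m : nat) :
    #[s] = (k * p ^ m)%N -> ~~ (p %| k) -> s ^+ k \in 'N(G) ->
  (G ><| <[s ^+ k]>) ><| <[s ^+ (p ^ m)]> = A.
Proof.
move=> os p'k nGsk.
have sCA : C \subset A by rewrite -defAT mulG_subr.
have skC : <[s ^+ k]> \subset C by apply: cycleX.
have spC : <[s ^+ (p ^ m)]> \subset C by apply: cycleX.
have k_gt0 : (0 < k)%N by rewrite lt0n; apply: contraNneq p'k => ->; rewrite dvdn0.
have pm_gt0 : (0 < p ^ m)%N by rewrite expn_gt0 prime_gt0.
have osk : #[s ^+ k] = (p ^ m)%N by rewrite orderXdiv os ?dvdn_mulr ?mulKn.
have osp : #[s ^+ (p ^ m)] = k by rewrite orderXdiv os ?dvdn_mull ?mulnK.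
have p_G := abelem_pgroup pG.
have pT : p.-group T by rewrite /pgroup card_complements_cycle.
have nTsk : <[s ^+ k]> \subset 'N(T).
  exact: subset_trans (subset_trans skC sCA) (normal_norm nsTA).
pose P := (T <*> <[s ^+ k]>)%G.
have defP : T * <[s ^+ k]> = P by rewrite /= norm_joinEr.
have psk : p.-group <[s ^+ k]> by rewrite /pgroup -orderE osk pnatX pnat_id.
have pP : p.-group P by rewrite -defP pgroupM pT.
have sPA : P \subset A by rewrite -defP mul_subG ?(normal_sub nsTA) ?(subset_trans skC).
have nsPA : P <| A.
  apply: sub_der1_normal sPA; apply: subset_trans (joing_subl _ _).
  by rewrite der1_min ?normal_norm ?abelian_quo_cyclic_complement.
have tiTsk : T :&: <[s ^+ k]> = 1 by apply/trivgP; rewrite -tiTC setIS.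
have tiGsk : G :&: <[s ^+ k]> = 1 by apply/trivgP; rewrite -tiGC setIS.
have cardP : #|P| = (#|T| * p ^ m)%N by rewrite -defP TI_cardMg // -orderE osk.
have cardA : #|A| = (#|P| * k)%N.
  by rewrite cardP -defAT TI_cardMg // -orderE os [(k * _)%N]mulnC mulnA.
have p'k' : p^'.-nat k by rewrite p'natE.
have hallP : p.-Hall(A) P.
  rewrite /pHall sPA pP -divgS // cardA mulKn ?cardG_gt0 //.
have sGP : G \subset P by rewrite (sub_normal_Hall hallP).
have defP' : G * <[s ^+ k]> = P.
  apply/eqP; rewrite eqEcard mul_subG ?joing_subr //=.
  by rewrite TI_cardMg // -orderE osk -card_complements_cycle -cardP.
rewrite [G ><| _]sdprodE ?cycle_subG // defP'.
have tiPsp : P :&: <[s ^+ (p ^ m)]> = 1.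
  by rewrite coprime_TIg // -orderE osp (pnat_coprime pP).
rewrite sdprodE //; last exact: subset_trans (subset_trans spC sCA) (normal_norm nsPA).
apply/eqP; rewrite eqEcard mul_subG ?(subset_trans spC) //=.
by rewrite TI_cardMg // -orderE osp cardA.
Qed.

Hypotheses (abT : abelian T) (cAG : 'C_A(G) \subset G) (cAT : 'C_A(T) \subset T).
Hypothesis (neGT : G :!=: T).

Local Notation W := (G :&: T).
Local Notation L := (G <*> T).

(** The image of G in the cyclic group A/T is elementary abelian, hence of order at most p; it is
    nontrivial because G and T are distinct of equal order. *)
Lemma index_capG_complement : #|G : W| = p.
Proof.
have nTG : G \subset 'N(T) := subset_trans sGA (normal_norm nsTA).
rewrite indexgI -card_quotient //.
have pGT : p.-abelem (G / T) by apply: quotient_abelem.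
have cycGT : cyclic (G / T).
  apply: (@cyclicS _ (A / T)); first exact: quotientS.
  have sCA : C \subset A by rewrite -defAT mulG_subr.
  have nTC : C \subset 'N(T) by apply: subset_trans sCA (normal_norm nsTA).
  by rewrite /= -defAT quotientMidl quotient_cyclic // cycle_cyclic.
have : #|G / T| != 1%N.
  rewrite -trivg_card1 -subG1 quotient_sub1 //; apply: contra neGT => sGT.
  by rewrite eqEcard sGT card_complements_cycle leqnn.
rewrite (abelem_cyclic pGT) in cycGT.
rewrite [#|_|](card_pgroup (abelem_pgroup pGT)).
by case: (logn _ _) cycGT => [|[|]].
Qed.

Lemma mulG_complement_join : G * T = L.
Proof. by rewrite norm_joinEl // (subset_trans sGA (normal_norm nsTA)). Qed.

Lemma join_complement_normal : L <| A.
Proof.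
apply: sub_der1_normal; last by rewrite join_subG sGA normal_sub.
apply: subset_trans (joing_subr _ _).
by rewrite der1_min ?normal_norm ?abelian_quo_cyclic_complement.
Qed.

(** A central element of L centralises G and T, both self-centralising in A; conversely W is
    centralised by the abelian groups G and T. *)
Lemma center_join_complement : 'Z(L) = W.
Proof.
have [sGL sTL] : G \subset L /\ T \subset L by rewrite joing_subl joing_subr.
have sLA := normal_sub join_complement_normal.
apply/eqP; rewrite eqEsubset; apply/andP; split.
  rewrite subsetI (subset_trans _ cAG) ?(subset_trans _ cAT) //.
    by rewrite setISS ?centS.
  by rewrite setISS ?centS.
rewrite subsetI subIset ?sGL //= centY subsetI.
apply/andP; split.
  exact: subset_trans (subsetIl _ _) (abelem_abelian pG).
exact: subset_trans (subsetIr _ _) abT.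
Qed.

Lemma capG_complement_normal : W <| A.
Proof. by rewrite -center_join_complement gFnormal_trans ?join_complement_normal. Qed.

Lemma card_capG_complement : #|G| = (#|W| * p)%N.
Proof. by rewrite -index_capG_complement Lagrange ?subsetIl. Qed.

Lemma card_join_complement : #|L| = (#|G| * p)%N.
Proof.
apply/eqP; rewrite -(eqn_pmul2r (cardG_gt0 W)) -mulG_complement_join.
by rewrite -mul_cardG -mulnA [(p * _)%N]mulnC -card_capG_complement card_complements_cycle.
Qed.

(** Dedekind's modular law. *)
Lemma mul_join_cap_cycle : G * (C :&: L) = L /\ T * (C :&: L) = L.
Proof.
have sLA := normal_sub join_complement_normal.
by split; rewrite group_modl ?joing_subl ?joing_subr ?(defAG, defAT) //; apply/setIidPr.
Qed.

Lemma expg_join_cap_cycle z : z \in C :&: L -> z ^+ p = 1.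
Proof.
move=> Cz; have cardCL : #|C :&: L| = p.
  have /TI_cardMg : G :&: (C :&: L)%G = 1 by apply/trivgP; rewrite -tiGC setIS ?subsetIl.
  rewrite /= mul_join_cap_cycle.1 card_join_complement => /eqP.
  by rewrite eqn_pmul2l // => /eqP.
by rewrite -cardCL expg_cardG.
Qed.

Lemma der1_join_complement : L^`(1) \subset W.
Proof.
have sWL : W \subset L by rewrite subIset ?joing_subl.
have nWL : L \subset 'N(W).
  exact: subset_trans (normal_sub join_complement_normal) (normal_norm capG_complement_normal).
apply: (der1_min (H := (G :&: T)%G)) => //; apply: (card_p2group_abelian p_pr).
rewrite card_quotient // -divgS //= card_join_complement card_capG_complement.
by rewrite -mulnA mulKn // mulnn.
Qed.

Lemma complement_abelem : odd p -> p.-abelem T.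
Proof.
move=> odd_p; apply/abelemP=> //; split=> // t Tt.
have : t \in G * (C :&: L) by rewrite mul_join_cap_cycle.1 (subsetP (joing_subr _ _)).
case/mulsgP=> g z Gg Cz ->{t Tt}.
have Lg : g \in L := subsetP (joing_subl _ _) g Gg.
have Lz : z \in L by case/setIP: Cz.
have Wzg : [~ z, g] \in W by rewrite (subsetP der1_join_complement) ?mem_commg.
have cW u : u \in L -> commute u [~ z, g].
  move: Wzg; rewrite -center_join_complement => /centerP[_ cL Lu].
  exact/commute_sym/cL.
have /abelemP[//|_ expG] := pG.
(* As [[~ z, g]] is central in L, (gz)^p = g^p z^p [z,g]^(p(p-1)/2). For odd p the last exponent is
   a multiple of p, and W, inside G, has exponent p. *)
rewrite (expMg_Rmul p (cW z Lz) (cW g Lg)) expG // (expg_join_cap_cycle Cz) !mul1g bin2odd //.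
by rewrite expgM expG ?expg1n //; case/setIP: Wzg.
Qed.

(** T/W is normal of order p in the p-group T<y>/W, hence central, so [T,y] lies in W. Elements of G
    have the form tz with z in C commuting with y, so y changes them only by factors in W. *)
Lemma complement_pelt_norm y : y \in C -> p.-elt y -> y \in 'N(G).
Proof.
move=> Cy py; have sCA : C \subset A by rewrite -defAT mulG_subr.
have Ay := subsetP sCA y Cy; have nWA := normal_norm capG_complement_normal.
have nTy : <[y]> \subset 'N(T).
  by rewrite cycle_subG (subsetP (normal_norm nsTA)).
pose P := (T <*> <[y]>)%G.
have pT : p.-group T.
  by rewrite /pgroup card_complements_cycle; apply: abelem_pgroup pG.
have pP : p.-group P by rewrite /= norm_joinEr // pgroupM pT.
have sPA : P \subset A by rewrite join_subG normal_sub ?cycle_subG.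
have nWP := subset_trans sPA nWA.
have nWT := subset_trans (normal_sub nsTA) nWA.
have prTW : prime #|T / W|.
  rewrite card_quotient // -divgS ?subsetIr // card_complements_cycle.
  by rewrite card_capG_complement mulKn ?cardG_gt0.
have cPT : T / W \subset 'Z(P / W).
  apply: prime_meetG => //; apply: meet_center_nil.
  - exact: pgroup_nil (quotient_pgroup _ pP).
  - apply: quotient_normal; rewrite /normal joing_subl join_subG normG.
    by rewrite nTy.
  by rewrite -cardG_gt1 prime_gt1.
have sTyW : [~: T, <[y]>] \subset W.
  rewrite -quotient_cents2 // ?cycle_subG ?(subsetP nWA) //.
  apply: subset_trans (subset_trans cPT (subsetIr _ _)) _.
  by rewrite centS ?quotientS ?joing_subr.
rewrite inE; apply/subsetP=> _ /imsetP[g Gg ->].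
have : g \in T * (C :&: L) by rewrite mul_join_cap_cycle.2 (subsetP (joing_subl _ _)).
case/mulsgP=> t z Tt /setIP[Cz Lz] def_g.
have zy : z ^ y = z.
  by rewrite conjgE (centsP (cycle_abelian s) z Cz y Cy) mulKg.
have -> : g ^ y = g * [~ t, y] ^ z.
  by rewrite def_g conjMg zy conjg_mulR conjgE !mulgA mulgK.
rewrite groupM // (subsetP (subsetIl G T)) // memJ_norm.
  by rewrite (subsetP sTyW) ?mem_commg ?cycle_id.
by rewrite (subsetP nWA) ?(subsetP sCA).
Qed.

(** W is the centre of the p-group L, which is nontrivial because G and T differ. This is what
    forces n >= 2. *)
Lemma capG_complement_neq1 : W != 1.
Proof.
have sTL : T \subset L := joing_subr _ _.
have pT : p.-group T.
  by rewrite /pgroup card_complements_cycle; apply: abelem_pgroup pG.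
have pL : p.-group L by rewrite -mulG_complement_join pgroupM pT abelem_pgroup.
rewrite -center_join_complement; apply: contra neGT => /eqP/(trivg_center_pgroup pL) L1.
have: G \subset L by apply: joing_subl.
by rewrite L1 in sTL * => /trivgP->; rewrite (trivgP sTL).
Qed.

End CyclicFactor.

(** * Transitive abelian permutation groups *)

Section TransitiveAbelian.

Variables (T : finType) (B : {group {perm T}}).
Hypothesis trB : [transitive B, on setT | 'P].

Lemma transitive_cent_astab1 x (f : {perm T}) : f \in 'C(B) -> f x = x -> f = 1.
Proof.
move=> cBf fx; apply/permP=> y; rewrite perm1.
have [b Bb ->] := atransP2 trB (in_setT x) (in_setT y).
have := congr1 (fun h : {perm T} => h x) (centP cBf b Bb).
by rewrite !permM fx /= => <-.
Qed.

Lemma transitive_abelian_cent_sub : abelian B -> 'C(B) \subset B.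
Proof.
move=> abB; apply/subsetP=> f cBf.
case: (pickP T) => [x _ | T0]; last first.
  suffices -> : f = 1 by [].
  by apply/permP=> y; have := T0 y.
have [b Bb fx] := atransP2 trB (in_setT x) (in_setT (f x)).
(* [f] and [b] agree at [x], so their quotient fixes a point and centralises [B]. *)
rewrite -(mulgKV b f) groupMl // (_ : f * b^-1 = 1) //.
apply: (@transitive_cent_astab1 x).
  by rewrite groupM // groupV (subsetP abB).
by rewrite permM fx /= permK.
Qed.

Lemma transitive_abelian_stab x : abelian B -> 'C_B[x | 'P] = 1.
Proof.
move=> abB; apply/trivgP/subsetP=> f /setIP[Bf /astab1P fx].
by rewrite inE (transitive_cent_astab1 (subsetP abB f Bf) fx).
Qed.

Lemma transitive_abelian_regular : abelian B -> acts_regularly B 'P [set: T].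
Proof.
move=> abB; split=> [|x y _ _]; first exact: atrans_acts trB.
have [b Bb ->] := atransP2 trB (in_setT x) (in_setT y).
by rewrite amove_act ?subsetT // transitive_abelian_stab // mul1g cards1.
Qed.

End TransitiveAbelian.

(** * The group of left translations *)

Section LeftRegularTheory.

Variable gT : finGroupType.
Local Notation G := (left_regular gT).

Lemma lmul_permE (g y : gT) : lmul_perm g y = g * y.
Proof. by rewrite permE. Qed.

(** The order is reversed because permutations compose from left to right. *)
Lemma lmul_permM (g h : gT) : lmul_perm (g * h) = lmul_perm h * lmul_perm g.
Proof. by apply/permP=> y; rewrite permM !lmul_permE mulgA. Qed.

Lemma lmul_perm1 : lmul_perm (1 : gT) = 1.
Proof. by apply/permP=> y; rewrite lmul_permE mul1g perm1. Qed.

Lemma lmul_permX (g : gT) i : lmul_perm (g ^+ i) = lmul_perm g ^+ i.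
Proof.
by elim: i => [|i IHi]; rewrite ?lmul_perm1 // expgSr lmul_permM IHi -expgS.
Qed.

Lemma mem_left_regular (g : gT) : lmul_perm g \in G.
Proof. exact: imset_f. Qed.

Lemma left_regular_gen_sub (S : {set gT}) (H : {group {perm gT}}) :
  <<S>> = [set: gT] -> {in S, forall s, lmul_perm s \in H} -> G \subset H.
Proof.
move=> genS sSH; pose K := [set g : gT | lmul_perm g \in H].
have gK : group_set K.
  apply/group_setP; split=> [|g h]; rewrite !inE ?lmul_perm1 ?group1 //.
  by move=> Hg Hh; rewrite lmul_permM groupM.
have : <<S>> \subset Group gK.
  by rewrite gen_subG; apply/subsetP=> s Ss; rewrite inE sSH.
rewrite genS => /subsetP sTK; apply/subsetP=> _ /imsetP[g _ ->].
by have := sTK g (in_setT g); rewrite inE.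
Qed.

Lemma left_regular_trans : [transitive G, on setT | 'P].
Proof.
apply/imsetP; exists 1; rewrite ?inE //; apply/esym/setP=> y; rewrite !inE.
apply/imsetP; exists (lmul_perm y); first exact: mem_left_regular.
by rewrite /= /aperm lmul_permE mulg1.
Qed.

Lemma left_regular_abelem p :
  prime p -> p.-abelem [set: gT] -> p.-abelem G.
Proof.
move=> p_pr /abelemP[//|/centsP abT expT]; apply/abelemP=> //; split.
  apply/centsP=> _ /imsetP[g _ ->] _ /imsetP[h _ ->].
  by rewrite /commute -!lmul_permM abT ?inE.
by move=> _ /imsetP[g _ ->]; rewrite -lmul_permX expT ?inE ?lmul_perm1.
Qed.

Lemma card_left_regular : #|G| = #|gT|.
Proof.
rewrite card_imset // => g h /permP/(_ 1).
by rewrite !lmul_permE !mulg1.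
Qed.

End LeftRegularTheory.

(** * Arc-reversing automorphisms of a regular Cayley map *)

Section RegularCayleyMap.

Variables (gT : finGroupType) (M : cayley_map gT).
Hypothesis regM : regular_cayley_map M.
Hypothesis abelG : abelian [set: gT].

Lemma cm_aut_arc_inj (x y : gT) (f h : {perm gT}) :
    x^-1 * y \in cm_set M -> f \in cm_aut M -> h \in cm_aut M ->
  f x = h x -> f y = h y -> f = h.
Proof.
move=> Sxy Af Ah fhx fhy; have arc_xy : (x, y) \in cm_arcs M by rewrite inE.
have arc_f : pair_action gT (x, y) f \in cm_arcs M.
  by have /cm_autP[-> _] := Af.
have := regM.2 _ _ arc_xy arc_f => /eqP/cards1P[a def_a].
have : f \in [set a] by rewrite -def_a; apply/setIdP.
have : h \in [set a].
  by rewrite -def_a; apply/setIdP; rewrite /= /pair_perm /= fhx fhy.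
by move/set1P=> -> /set1P->.
Qed.

Lemma cm_aut_arc_flip (x s : gT) : s \in cm_set M ->
  exists2 i, i \in cm_aut M & i x = x * s /\ i (x * s) = x.
Proof.
move=> Ss; have arc_xs : (x, x * s) \in cm_arcs M by rewrite inE /= mulKg.
have arc_sx : (x * s, x) \in cm_arcs M.
  by rewrite inE /= invMg mulgKV cm_setV.
have := regM.2 _ _ arc_xs arc_sx => /eqP/cards1P[i def_i].
have : i \in [set i] by rewrite set11.
by rewrite -def_i => /setIdP[Ai /eqP[ix isx]]; exists i.
Qed.

Lemma cm_aut_trans : [transitive cm_aut M, on setT | 'P].
Proof.
rewrite (atrans_supgroup (left_regular_sub_aut M) (left_regular_trans gT)).
by apply/actsP=> f _ y; rewrite !in_setT.
Qed.

(** In exponent 2, translation by [s] reverses the arc from [x] to [x * s]. Its conjugate by [f]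
    reverses the image arc at [x], hence is again a translation, by regularity on arcs. *)
Lemma cm_aut_stab_norm2 x (f : {perm gT}) :
    2.-abelem [set: gT] -> f \in 'C_(cm_aut M)[x | 'P] ->
  f \in 'N(left_regular gT).
Proof.
move=> G2 /setIP[Af /astab1P]; rewrite /= /aperm => fx.
have cG a b : a * b = b * a :> gT by apply: (centsP abelG); rewrite inE.
have sqG (a : gT) : a * a = 1.
  by have /abelemP[//|_ /(_ a)] := G2; apply; rewrite inE.
rewrite inE sub_conjg; apply: (left_regular_gen_sub (cm_gen M)) => s Ss.
have Sfxs : x^-1 * f (x * s) \in cm_set M.
  have /cm_autP[/(_ (x, x * s))] := Af.
  by rewrite !inE /= fx mulKg Ss.
set s' := x^-1 * f (x * s) in Sfxs.
have fxs : f (x * s) = x * s' by rewrite mulKVg.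
clearbody s'.
rewrite mem_conjgV (_ : _ ^ _ = lmul_perm s') ?mem_left_regular //.
have AL g : lmul_perm g \in cm_aut M.
  by rewrite (subsetP (left_regular_sub_aut M)) ?mem_left_regular.
apply: (cm_aut_arc_inj (x := x) (y := x * s')); rewrite ?mulKg ?groupJ //.
  by rewrite -{1}fx permJ !lmul_permE cG fxs cG.
rewrite -fxs permJ !lmul_permE fxs [s' * _]cG [s * _]cG -!mulgA !sqG !mulg1.
by rewrite fx.
Qed.

(* The translation along an arc at [x] agrees at [x] with the involution      *)
(* flipping that arc; hence its square lies in the subgroup on the right, and *)
(* its order is odd.                                                          *)
Lemma left_regular_sub_der1_stab x (sigma : {perm gT}) p :
    prime p -> odd p -> p.-abelem [set: gT] ->
    'C_(cm_aut M)[x | 'P] = <[sigma]> ->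
  left_regular gT \subset (cm_aut M)^`(1) <*> <[sigma]>.
Proof.
move=> p_pr odd_p Gp stabE; set K := _ <*> _.
have sKA : K \subset cm_aut M by rewrite join_subG der_sub -stabE subsetIl.
have nsKA : K <| cm_aut M by apply: sub_der1_normal; rewrite ?joing_subl.
apply: (left_regular_gen_sub (cm_gen M)) => s Ss.
set t := lmul_perm s.
have cG a b : a * b = b * a :> gT by apply: (centsP abelG); rewrite inE.
have At : t \in cm_aut M.
  by rewrite (subsetP (left_regular_sub_aut M)) ?mem_left_regular.
have [i Ai [ix ixs]] := cm_aut_arc_flip x Ss.
have ii : i * i = 1.
  apply: (@cm_aut_arc_inj x (x * s)); rewrite ?mulKg ?groupM ?group1 //.
    by rewrite permM ix ixs perm1.
  by rewrite permM ixs ix perm1.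
have Kti : t * i^-1 \in K.
  rewrite (subsetP (joing_subr _ _)) // -stabE; apply/setIP.
  split; first by rewrite groupM ?groupV.
  by apply/astab1P; rewrite /= /aperm permM lmul_permE cG -ix permK.
have Kt2 : t ^+ 2 \in K.
  have -> : t ^+ 2 = (t * i^-1) * (t * i^-1) ^ i^-1.
    have iV : i^-1 = i by apply/eqP; rewrite eq_invg_mul ii.
    by rewrite iV conjgE iV -!mulgA ii mulg1 (mulgA i i) ii mul1g.
  by rewrite groupM // memJ_norm // groupV (subsetP (normal_norm nsKA)).
have tp : t ^+ p = 1.
  by rewrite -lmul_permX; have /abelemP[//|_ ->] := Gp; rewrite ?inE ?lmul_perm1.
(* For odd p the exponent is (p+1)/2, so the right-hand side is t^(p+1) = t. *)
have -> : t = (t ^+ 2) ^+ (p./2.+1).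
  rewrite -expgM mulnS mul2n expgD.
  have := odd_double_half p; rewrite odd_p add1n => def_p.
  by rewrite -[in LHS](mulg1 t) -tp -[in LHS]def_p expgS expgS mulgA.
exact: groupX.
Qed.

End RegularCayleyMap.

(** * The row-space model of Z_p^n, and the assembly of the proof *)

Lemma rV_Fp_abelem p n : prime p -> p.-abelem [set: 'rV['F_p]_n].
Proof.
move=> p_pr; apply/abelemP=> //; split=> [|v _]; first exact: FinRing.zmod_abelian.
by rewrite FinRing.zmodXgE -GRing.scaler_nat pchar_Fp_0 // GRing.scale0r.
Qed.

Lemma card_rV_Fp p n : prime p -> #|[set: 'rV['F_p]_n]| = (p ^ n)%N.
Proof. by move=> p_pr; rewrite cardsT card_mx mul1n card_Fp. Qed.

Theorem theorem1p1 (p n : nat) (gT : finGroupType) (M : cayley_map gT)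
    (x : gT) (sigma : {perm gT}) (k m : nat)
    (p_prime : prime p)
    (G_elem : [set: gT]%g \isog [set: 'rV['F_p]_n]%g)
    (M_regular : regular_cayley_map M)
    (stab_sigma : ('C_(cm_aut M)[x | 'P])%g = <[sigma]>%g)
    (order_sigma : #[sigma]%g = (k * p ^ m)%N)
    (k_coprime : ~~ (p %| k)) :
  ((left_regular gT ><| <[sigma ^+ k]>) ><| <[sigma ^+ (p ^ m)%N]>)%g
    = cm_aut M
  /\ (exists T : {group {perm gT}},
        [/\ (T <| cm_aut M)%g,
            T \isog [set: 'rV['F_p]_n]%g,
            acts_regularly T ('P)%act [set: gT]
          & T = left_regular gT :> {set {perm gT}}
            \/ (1 < n)%N
               /\ (T :&: left_regular gT)%g \isog [set: 'rV['F_p]_n.-1]%g]).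
Proof.
have Gp : p.-abelem [set: gT] by rewrite (isog_abelem G_elem) rV_Fp_abelem.
have abG := abelem_abelian Gp.
pose A := [group of cm_aut M]; pose G := [group of left_regular gT].
have pG : p.-abelem G := left_regular_abelem p_prime Gp.
have cardG : #|G| = (p ^ n)%N.
  by rewrite card_left_regular -cardsT (card_isog G_elem) card_rV_Fp.
have sGA : G \subset A := left_regular_sub_aut M.
have trA := cm_aut_trans M.
have isog_rV (T : {group {perm gT}}) i :
    p.-abelem T -> #|T| = (p ^ i)%N -> T \isog [set: 'rV['F_p]_i].
  move=> pT cardT.
  by rewrite (isog_abelem_card _ pT) rV_Fp_abelem //= card_rV_Fp // cardT eqxx.
have complP (T : {group {perm gT}}) : T \subset A -> abelian T ->
    [transitive T, on setT | 'P] -> T * <[sigma]> = A /\ T :&: <[sigma]> = 1.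
  move=> sTA abT trT; split.
    have /(subgroup_transitiveP (in_setT x) sTA trA) := trT.
    rewrite stab_sigma => defA.
    have cCT : commute <[sigma]> T by apply/comm_group_setP; rewrite defA groupP.
    by rewrite -cCT.
  by rewrite -stab_sigma setIA (setIidPl sTA) transitive_abelian_stab.
have [defAG tiGC] := complP G sGA (abelem_abelian pG) (left_regular_trans gT).
have [T [nsTA abT trT]] : exists T : {group {perm gT}},
    [/\ T <| A, abelian T, [transitive T, on setT | 'P]
      & T :=: G \/ odd p].
  have [p2 | odd_p] := even_prime p_prime.
    exists G; split; [| exact: abelem_abelian pG | exact: left_regular_trans |by left].
    rewrite /normal sGA -defAG mul_subG ?normG // cycle_subG.
    rewrite (cm_aut_stab_norm2 M_regular abG (x := x)) -?p2 //.
    by rewrite stab_sigma cycle_id.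
  exists (cm_aut_group M)^`(1)%G; split; last by right.
  - exact: der_normal.
  - by apply: der1_mul_abelian defAG; rewrite ?cycle_abelian ?(abelem_abelian pG).
  have sTA := der_sub 1 (cm_aut_group M).
  (* Transitivity of A' amounts to A = A'C, which holds because A'C contains both G and C. *)
  apply/(subgroup_transitiveP (in_setT x) sTA trA); rewrite stab_sigma.
  have sGK := left_regular_sub_der1_stab M_regular abG p_prime odd_p Gp stab_sigma.
  have sCA : <[sigma]> \subset A by rewrite -stab_sigma subsetIl.
  have nTC : <[sigma]> \subset 'N((cm_aut M)^`(1)).
    by rewrite (subset_trans sCA) ?der_norm.
  apply/eqP; rewrite -norm_joinEl // eqEsubset join_subG sCA sTA /=.
  by rewrite joingC -{1}[cm_aut M]defAG mul_subG ?joing_subr.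
move=> TG_or_odd.
have [defAT tiTC] := complP T (normal_sub nsTA) abT trT.
have regT := transitive_abelian_regular trT abT.
have [eqGT | neGT] := eqVneq (G : {set _}) T.
  have nGsk : sigma ^+ k \in 'N(G).
    rewrite eqGT groupX // (subsetP (normal_norm nsTA)) // -defAT.
    by rewrite (subsetP (mulG_subr _ _)) ?cycle_id.
  split; first exact: (sdprod_cycle_constituents p_prime pG nsTA sGA) order_sigma k_coprime nGsk.
  exists T; split=> //; last by left.
  by apply: isog_rV; rewrite -eqGT.
have odd_p : odd p by case: TG_or_odd neGT => // ->; rewrite eqxx.
have cA (B : {group {perm gT}}) :
    abelian B -> [transitive B, on setT | 'P] -> 'C_A(B) \subset B.
  move=> abB trB; apply: subset_trans (subsetIr _ _) _.
  exact: transitive_abelian_cent_sub.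
have cAG := cA G (abelem_abelian pG) (left_regular_trans gT).
have cAT := cA T abT trT.
have pT : p.-abelem T.
  exact: complement_abelem p_prime pG nsTA sGA defAG defAT tiGC tiTC abT cAG cAT neGT odd_p.
have W1 : G :&: T != 1.
  exact: capG_complement_neq1 pG nsTA sGA defAG defAT tiGC tiTC abT cAG cAT neGT.
have := card_capG_complement pG nsTA sGA defAG defAT tiGC tiTC neGT.
have nGsk : sigma ^+ k \in 'N(G).
  apply: (complement_pelt_norm p_prime pG nsTA sGA defAG defAT tiGC tiTC abT cAG cAT neGT).
    exact: mem_cycle.
  have k_gt0 : (0 < k)%N by rewrite lt0n; apply: contraNneq k_coprime => ->.
  by rewrite /p_elt orderXdiv order_sigma ?dvdn_mulr // mulKn // pnatX pnat_id.
rewrite cardG => cardW; split.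
  exact: (sdprod_cycle_constituents p_prime pG nsTA sGA) order_sigma k_coprime nGsk.
(* For n = 0 the equation |G| = |W| p would read 1 = |W| p. *)
have n_gt0 : (0 < n)%N.
  rewrite lt0n; apply: contra_eqN cardW => /eqP->.
  by rewrite eq_sym muln_eq1 (gtn_eqF (prime_gt1 p_prime)) andbF.
have cardW' : #|G :&: T| = (p ^ n.-1)%N.
  apply/eqP; rewrite -(eqn_pmul2r (prime_gt0 p_prime)) -cardW.
  by rewrite -expnSr prednK.
exists T; split=> //.
  by apply: isog_rV => //; rewrite (card_complements_cycle defAG defAT tiGC tiTC).
right; split.
  by move: W1; rewrite -cardG_gt1 cardW'; case: (n) n_gt0 => [|[|]].
rewrite setIC; apply: (isog_rV (G :&: T)%G) => //.
exact: abelemS (subsetIl _ _) pG.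
Qed.
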